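(* Let $G$ be a split graph on $d-1$ nodes, whose node set is partitioned into a clique $C$ and a stable set $S$. Then the Hansen polytope $\mathrm{H}(G)$ satisfies $$\mathrm{s}(\mathrm{H}(G)) = 3^d + p_G(C,S),$$ where $\mathrm{s}(\mathrm{H}(G))$ is the number of nonempty faces of $\mathrm{H}(G)$. In particular, the Hansen polytope of every split graph satisfies the $3^d$-conjecture, i.e. $\mathrm{s}(\mathrm{H}(G))\ge 3^d$, where $d=\dim \mathrm{H}(G)$.
   Context: All graphs are finite and simple. A graph $G$ is a split graph if its node set can be partitioned into a clique $C$ and a stable set $S$ (either may be empty); we write $G=C\cup S$. For a graph $G=(V,E)$, the stable set polytope is $\mathrm{stab}(G)=\mathrm{conv}\{\sum_{i\in I}e_i : I\subseteq V \text{ stable}\}\subseteq\mathbb{R}^{V}$ (the empty set is stable). The twisted prism of a polytope $P\subseteq\mathbb{R}^n$ is $\mathrm{tp}(P)=\mathrm{conv}(Q\cup -Q)\subseteq\mathbb{R}^{n+1}$ with $Q=\{1\}\times P$. The Hansen polytope of $G$ is $\mathrm{H}(G)=\mathrm{tp}(\mathrm{stab}(G))$; it is centrally symmetric of dimension $|V|+1$. For a polytope $P$, $\mathrm{s}(P)$ is the number of nonempty faces of $P$, with $P$ itself counted as a face. The $3^d$-conjecture asserts that every centrally symmetric $d$-dimensional polytope $P$ (i.e. $P=-P$) has $\mathrm{s}(P)\ge 3^d$. For a split graph $G=C\cup S$, $p_G(C,S)$ is the number of ordered tuples $(C^+,C^-,C^0,S^+,S^-,S^0)$ of (possibly empty)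 sets such that $C$ is the disjoint union of $C^+,C^-,C^0$, $S$ is the disjoint union of $S^+,S^-,S^0$, at least one of $C^+\cup C^-$ and $S^+\cup S^-$ is nonempty, and: (A) every element of $C^+\cup C^-$ has a neighbor in $S^+\cup S^-$; (B) every element of $S^+\cup S^-$ has a nonneighbor in $C^+\cup C^-$. *)

(* Defs.v *)
From HB Require Import structures.
From mathcomp Require Import all_boot all_order all_algebra finmap.
From mathcomp Require Import boolp classical_sets functions cardinality reals.
From mathcomp Require Import convex.

Set Implicit Arguments.
Unset Strict Implicit.
Unset Printing Implicit Defensive.

Import Order.TTheory GRing.Theory Num.Theory.

Definition simple_graph (V : finType) (e : rel V) : Prop :=
  symmetric e /\ irreflexive e.

Definition clique (V : finType) (e : rel V) (C : {set V}) : bool :=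
  [forall x in C, forall y in C, (x != y) ==> e x y].

Definition stable (V : finType) (e : rel V) (S : {set V}) : bool :=
  [forall x in S, forall y in S, ~~ e x y].

Definition split_partition (V : finType) (e : rel V) (C S : {set V}) : Prop :=
  [/\ C :|: S = [set: V], [disjoint C & S], clique e C & stable e S].

Definition disjoint_union3 (V : finType) (A X Y Z : {set V}) : bool :=
  [&& A == X :|: Y :|: Z, [disjoint X & Y], [disjoint X & Z]
    & [disjoint Y & Z]].

Definition p_count (V : finType) (e : rel V) (C S : {set V}) : nat :=
  #|[set t : {set V} * {set V} * {set V} * {set V} * {set V} * {set V} |
      let: (Cp, Cm, C0, Sp, Sm, S0) := t in
      [&& disjoint_union3 C Cp Cm C0,
          disjoint_union3 S Sp Sm S0,
          (Cp :|: Cm != finset.set0) || (Sp :|: Sm != finset.set0),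
          [forall x in Cp :|: Cm, exists y in Sp :|: Sm, e x y]
        & [forall y in Sp :|: Sm, exists x in Cp :|: Cm, ~~ e y x]]]|.

Local Open Scope classical_set_scope.
Local Open Scope ring_scope.

Definition convex_hull (R : realType) (E : lmodType R) (A : set E) : set E :=
  smallest (@convex_set R E) A.

Definition centrally_symmetric (R : realType) (E : lmodType R) (P : set E) : Prop :=
  P = -%R @` P.

(* Taking c = 0 shows that P is a face of itself. *)
Definition face (R : realType) (E : lmodType R) (P F : set E) : Prop :=
  exists (c : {scalar E}) (b : R),
    (forall x, P x -> c x <= b) /\ F = P `&` [set x | c x = b].

(* [fset_set] is empty on infinite sets, but a polytope has finitely many
   faces. *)
Definition face_count (R : realType) (E : lmodType R) (P : set E) : nat :=
  #|` fset_set [set F | face P F /\ F !=set0] |.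

Definition affine_subspace (R : realType) (E : vectType R) (x : E)
    (U : {vspace E}) : set E :=
  [set x + u | u in [set u | u \in U]].

Definition affine_set (R : realType) (E : vectType R) (A : set E) : Prop :=
  exists x U, A = affine_subspace x U.

Definition affine_hull (R : realType) (E : vectType R) (A : set E) : set E :=
  smallest (@affine_set R E) A.

(* The direction of an affine subspace is unique, so for nonempty P the choice
   made by [xget] is forced. *)
Definition dimension (R : realType) (E : vectType R) (P : set E) : nat :=
  \dim (xget 0%VS [set U | exists x, affine_hull P = affine_subspace x U]).

(* R^V; the regular module R^o provides the vector space structure. *)
Definition unit_vector (R : realType) (V : finType) (i : V) : {ffun V -> R^o} :=
  [ffun j => (j == i)%:R].

Definition stab (R : realType) (V : finType) (e : rel V) :
    set {ffun V -> R^o} :=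
  convex_hull
    [set \sum_(i in I) unit_vector R i | I in [set I : {set V} | stable e I]].
Arguments stab : clear implicits.
Arguments stab R {V} e _.

Definition twisted_prism (R : realType) (E : vectType R) (P : set E) :
    set (R^o * E)%type :=
  let Q := [set (1 : R^o, x) | x in P] in convex_hull (Q `|` -%R @` Q).

Definition hansen (R : realType) (V : finType) (e : rel V) :
    set (R^o * {ffun V -> R^o})%type :=
  twisted_prism (stab R e).
Arguments hansen : clear implicits.
Arguments hansen R {V} e _.

(* Main.v *)
Require Import Defs.
From HB Require Import structures.
From mathcomp Require Import all_boot all_order all_algebra finmap lra.
From mathcomp Require Import boolp classical_sets cardinality reals.
From mathcomp Require Import interval_inference convex.

(** A nonempty face of a polytope is determined by the vertices that it
contains, and these are the vertices at which some functional is maximal. The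
vertices of the Hansen polytope are the points [(-1)^s (1, 1_I)] with [s] a sign
and [I] a stable set, so the possible sets of maximizers [(s, I)] of
[(-1)^s (h + \sum_(i in I) a i)] have to be counted.

In a split graph, whose stable set [S] is written [~: C] below, a stable set
contains at most one element of [C]. Its branch is [None] if it contains none
and [Some c] if it contains [c]; its other elements form an arbitrary set of
elements of [S] that are available on the branch: all of [S] for [None], the
nonneighbors of [c] for [Some c]. On the branch [o] and with the sign [s] the
maximum [branch_max] takes or leaves each available [i] according to the sign
of [(-1)^s a i]. Since [h] and the coefficients on [C] are free, the only
relation between these maxima is that the two maxima on [o] add up to the sum
[mass o] of the available [`|a i|] ([branch_max_sum]). If [b] is the overall
maximum then [mass o <= 2 b], with equality if and only if [o] attains [b] with
both signs. The mass is largest for [None] ([mass_leif]). So either no branch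
attains [b] with both signs, or [None] does, and then [Some c] does exactly
when no neighbor of [c] in [S] has a nonzero coefficient.

Hence a face is the same thing as two bits, telling whether [None] attains [b]
with the sign [+] and with the sign [-], and a vector [r] of signs [+], [-], [0]:
on [C] it records the sign with which [Some c] attains [b] ([0] for neither or
both), on [S] it records the sign of [a i], if some maximizer can see it. Both
bits can be set exactly when [r] has property (A) in the definition of [p_G]; if
one bit is set then [r] is arbitrary; if no bit is set then [r] needs property (B)
and must not vanish on [C] ([functional_code], [code_functional],
[code_face_inj]).

Finally, a signed [c] without signed neighbors is a nonneighbor of every signed
element of [S]. So each [r] satisfies (A), or else (B) and does not vanish on
[C], and the vectors that satisfy both are those counted by [p_G]. With [n]
nodes this gives [2 * 3 ^ n + (3 ^ n + p_G)] faces, where [d = n + 1]. *)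

Set Implicit Arguments.
Unset Strict Implicit.
Unset Printing Implicit Defensive.

Import Order.TTheory GRing.Theory Num.Theory.

(** * Faces of the hull of finitely many points *)

Section ConvexHull.
Local Open Scope classical_set_scope.
Local Open Scope ring_scope.

Lemma convex_setE (R : realType) (E : lmodType R) (A : set E) :
  @convex_set R E A <->
  forall x y (t : R), 0 <= t <= 1 -> A x -> A y -> A (t *: x + (1 - t) *: y).
Proof.
split=> cA x y t.
  move=> /andP[t0 t1] Ax Ay.
  by have /set_mem := cA x y (Itv01 t0 t1) (mem_set Ax) (mem_set Ay).
move=> /set_mem Ax /set_mem Ay; apply/mem_set.
by apply: cA => //; rewrite ge0 le1.
Qed.

Lemma sub_convex_hull (R : realType) (E : lmodType R) (A : set E) :
  A `<=` convex_hull A.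
Proof. exact: sub_gen_smallest. Qed.

Lemma convex_hull_min (R : realType) (E : lmodType R) (A B : set E) :
  @convex_set R E B -> A `<=` B -> convex_hull A `<=` B.
Proof. exact: smallest_sub. Qed.

Lemma convex_hull_convex (R : realType) (E : lmodType R) (A : set E) :
  @convex_set R E (convex_hull A).
Proof.
apply/convex_setE => x y t t01 Ax Ay B [cB AB].
have /convex_setE cB' := cB.
by apply: cB' => //; [apply: Ax|apply: Ay].
Qed.

Lemma convex_hull_mono (R : realType) (E : lmodType R) (A B : set E) :
  A `<=` B -> convex_hull A `<=` convex_hull B.
Proof.
move=> AB; apply: (convex_hull_min (@convex_hull_convex R E B)).
by apply: (subset_trans AB); exact: sub_convex_hull.
Qed.

(** The image of a hull lies in any convex set that contains the image of the
generators, because preimages of convex sets under affine maps are convex. *)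
Lemma convex_hull_affine (R : realType) (E F : lmodType R) (f : E -> F)
    (A : set E) (B : set F) :
  (forall x y (t : R), f (t *: x + (1 - t) *: y) = t *: f x + (1 - t) *: f y) ->
  @convex_set R F B -> (forall x, A x -> B (f x)) ->
  forall x, convex_hull A x -> B (f x).
Proof.
move=> faff /convex_setE cB AB x.
apply: (convex_hull_min (B := f @^-1` B)) => //.
by apply/convex_setE => y z t t01 /= By Bz; rewrite faff; apply: cB.
Qed.

Lemma convex_hull_le (R : realType) (E : lmodType R) (c : {scalar E}) (b : R)
    (A : set E) :
  (forall x, A x -> c x <= b) -> forall x, convex_hull A x -> c x <= b.
Proof.
move=> cb; apply: convex_hull_min => //.
apply/convex_setE => x y t /andP[t0 t1] /= cx cy.
by rewrite linearD !linearZ /=; nra.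
Qed.

Lemma convex_hull_eq (R : realType) (E : lmodType R) (c : {scalar E}) (b : R)
    (A : set E) :
  (forall x, A x -> c x = b) -> forall x, convex_hull A x -> c x = b.
Proof.
move=> cb; apply: convex_hull_min => //.
apply/convex_setE => x y t _ /= cx cy.
by rewrite linearD !linearZ /= cx cy; lra.
Qed.

(** A convex combination of values at most [b] reaches [b] only if both values
do or one weight vanishes, so being at most [b], with equality only on the hull
of the maximizers, is a convex condition. *)
Lemma convex_hull_maximizers (R : realType) (E : lmodType R) (c : {scalar E})
    (b : R) (A : set E) :
  (forall x, A x -> c x <= b) ->
  convex_hull A `&` [set x | c x = b] = convex_hull (A `&` [set x | c x = b]).
Proof.
move=> cb; apply/seteqP; split=> [x [Ax cxb]|x Ax]; last first.
  split; first by apply: convex_hull_mono Ax => y [].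
  by apply: convex_hull_eq Ax => y [].
set D := A `&` _.
suff [_] : c x <= b /\ (c x = b -> convex_hull D x) by apply.
have := Ax; apply: (convex_hull_min
  (B := [set y | c y <= b /\ (c y = b -> convex_hull D y)])); last first.
  by move=> y Ay; split; [exact: cb|move=> cy; exact: sub_convex_hull].
apply/convex_setE => y z t /andP[t0 t1] /= [cy hy] [cz hz].
rewrite linearD !linearZ /=; split; first by nra.
have [->|tn0] := eqVneq t 0.
  by rewrite subr0 scale0r add0r scale1r mul0r add0r mul1r.
have [->|tn1] := eqVneq t 1.
  by rewrite subrr scale0r addr0 scale1r mul0r addr0 mul1r.
have {tn0}t0' : 0 < t by rewrite lt_neqAle eq_sym tn0.
have {tn1}t1' : t < 1 by rewrite lt_neqAle tn1.
move=> e; have /convex_setE ch := @convex_hull_convex R E D.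
by apply: ch; [rewrite t0 t1|apply: hy; nra|apply: hz; nra].
Qed.

Lemma convex_hull_set0 (R : realType) (E : lmodType R) :
  convex_hull (set0 : set E) = set0.
Proof.
by apply/seteqP; split=> //; apply: convex_hull_min => //; apply/convex_setE.
Qed.

Lemma card_fset_set_finset (T : finType) (U : choiceType) (f : T -> U)
    (A : {set T}) :
  {in A &, injective f} ->
  #|` fset_set [set f x | x in [set x | x \in A]] | = #|A|.
Proof.
move=> finj.
rewrite fset_set_image ?card_in_imfset //=; last first.
  move=> x y; rewrite !in_fset_set // => xA yA.
  by apply: finj; [move/set_mem: xA|move/set_mem: yA].
rewrite -[RHS]card_finset; congr #|` _|; apply/fsetP => x.
by rewrite in_fset_set //= in_fset; apply/idP/idP => [/set_mem|/mem_set].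
Qed.

Definition supporting (R : realType) (E : lmodType R) (T : finType) (w : T -> E)
    (A X : {set T}) : Prop :=
  exists (c : {scalar E}) (b : R),
    (forall t, t \in A -> c (w t) <= b) /\
    (forall t, (t \in X) = (t \in A) && (c (w t) == b)).

(** A face is the hull of the listed points on which its functional is maximal,
and its functional tells these points from the others, so the two determine each
other. *)
Lemma face_count_convex_hull (R : realType) (E : lmodType R) (T : finType)
    (w : T -> E) (A : {set T}) :
  face_count (convex_hull [set w t | t in [set t | t \in A]]) =
  #|finset (fun X : {set T} => (X != finset.set0) && `[< supporting w A X >])|.
Proof.
set hull := fun X : {set T} => convex_hull [set w t | t in [set t | t \in X]].
rewrite -/(hull A) -(card_fset_set_finset (f := hull)); last first.
  move=> X Y; rewrite !inE => /andP[_ /asboolP sX] /andP[_ /asboolP sY] XY.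
  have sub (X' Y' : {set T}) : supporting w A X' -> supporting w A Y' ->
      hull X' = hull Y' -> {subset X' <= Y'}.
    move=> [c [b [cb cX]]] [c' [b' [cb' cY]]] XY' t tX.
    have : hull Y' (w t) by rewrite -XY'; apply: sub_convex_hull; exists t.
    have tA : t \in A by move: tX; rewrite cX => /andP[].
    rewrite cY tA /= => Y't; apply/eqP; apply: (convex_hull_eq _ Y't).
    by move=> _ [u /= uY <-]; move: uY; rewrite cY => /andP[_ /eqP].
  by apply/setP => t; apply/idP/idP; apply: sub.
congr #|` fset_set _|; apply/seteqP; split=> F /=.
  move=> [[c [b [cb ->]]] F0].
  have cbA t : t \in A -> c (w t) <= b.
    by move=> tA; apply: cb; apply: sub_convex_hull; exists t.
  pose X := finset (fun t => (t \in A) && (c (w t) == b)).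
  have FX : hull A `&` [set x | c x = b] = hull X.
    rewrite convex_hull_maximizers => [|x [t /= tA <-]]; last exact: cbA.
    congr convex_hull; apply/seteqP; split=> x /=.
      by move=> [[t /= tA <-] /eqP ctb]; exists t; rewrite ?inE /= ?tA.
    by move=> [t]; rewrite /= inE => /andP[tA /eqP ctb] <-; split=> //; exists t.
  exists X => //; rewrite inE; apply/andP; split; last first.
    by apply/asboolP; exists c, b; split=> // t; rewrite inE.
  apply/negP => /eqP X0; case: F0 => x; rewrite FX /hull X0.
  rewrite (_ : [set w t | t in _] = set0) ?convex_hull_set0 //.
  by apply/seteqP; split=> // y [t]; rewrite /= inE.
move=> [X]; rewrite inE => /andP[/set0Pn[t tX] /asboolP[c [b [cb cX]]]] <-.
split; last by exists (w t); apply: sub_convex_hull; exists t.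
exists c, b; split; first by apply: convex_hull_le => _ [u /= uA <-]; exact: cb.
rewrite convex_hull_maximizers => [|_ [u /= uA <-]]; last exact: cb.
congr convex_hull; apply/seteqP; split=> x /=.
  by move=> [u]; rewrite /= cX => /andP[uA /eqP cu] <-; split=> //; exists u.
by move=> [[u /= uA <-] /eqP cu]; exists u; rewrite ?inE /= ?cX ?uA.
Qed.
End ConvexHull.

(** * Vertices, symmetry and dimension of the Hansen polytope *)

Section Hansen.
Local Open Scope classical_set_scope.
Local Open Scope ring_scope.
Variables (R : realType) (V : finType) (e : rel V).
Local Notation E := (R^o * {ffun V -> R^o})%type.

(** The sign is the exponent of [-1], so [false] stands for [+]. *)
Definition signed_stable_sets : {set bool * {set V}} :=
  finset (fun t : bool * {set V} => stable e t.2).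

Definition vertex (t : bool * {set V}) : E :=
  (-1) ^+ t.1 *: (1 : R^o, \sum_(i in t.2) unit_vector R i).

(** The map [x |-> (-1)^s (1, x)] is affine, so it maps the stable set polytope
into the hull of the images of the generators of this polytope. *)
Lemma hansen_vertices :
  hansen R e =
  convex_hull [set vertex t | t in [set t | t \in signed_stable_sets]].
Proof.
set W := [set vertex t | t in _].
apply/seteqP; split.
  have lift (s : bool) x :
      stab R e x -> convex_hull W ((-1) ^+ s *: (1 : R^o, x)).
    apply: (convex_hull_affine (f := fun x => (-1) ^+ s *: (1 : R^o, x) : E));
      [|exact: convex_hull_convex|].
      move=> y z t; rewrite !scalerA ![_ * (-1) ^+ s]mulrC -!scalerA -scalerDr.
      congr (_ *: (_, _)) => /=; rewrite /GRing.scale /= !mulr1; lra.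
    move=> _ [I /= sI <-]; apply: sub_convex_hull; exists (s, I) => //=.
    by rewrite inE.
  apply: (convex_hull_min (@convex_hull_convex R E W)).
  move=> _ [[x Px <-]|[_ [x Px <-] <-]].
    by have := lift false x Px; rewrite expr0 scale1r.
  by have := lift true x Px; rewrite expr1 scaleN1r.
apply: convex_hull_mono => x [[s I] /=]; rewrite inE /= => sI <-{x}.
have QI : [set (1 : R^o, x) | x in stab R e] (1, \sum_(i in I) unit_vector R i).
  by eexists; [apply: sub_convex_hull; exists I|].
rewrite /vertex; case: s => /=; [right|left]; last by rewrite expr0 scale1r.
by rewrite expr1 scaleN1r; eexists; first exact: QI.
Qed.

Lemma hansen_centrally_symmetric : centrally_symmetric (hansen R e).
Proof.
have opp x : hansen R e x -> hansen R e (- x).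
  rewrite hansen_vertices.
  apply: (convex_hull_affine (f := fun y : E => - y)) => [y z t||].
  - by rewrite opprD !scalerN.
  - exact: convex_hull_convex.
  move=> y [[s I] /=]; rewrite inE /= => sI <-{y}; apply: sub_convex_hull.
  exists (~~ s, I); first by rewrite /= inE.
  rewrite /vertex /=; case: s {sI} => /=;
    by rewrite expr0 expr1 scaleN1r scale1r ?opprK.
apply/seteqP; split=> [x /opp Px|_ [x /opp Px <-]//].
by exists (- x); rewrite // opprK.
Qed.

(** The direction of an affine space that contains the polytope contains half the
difference [(1, 1_I)] of each pair of opposite vertices. The empty set and the
singletons are stable and already yield a basis of the whole space. *)
Lemma dimension_hansen : irreflexive e -> dimension (hansen R e) = #|V|.+1.
Proof.
move=> e_irr.
have Pvertex s I : stable e I -> hansen R e (vertex (s, I)).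
  move=> sI; rewrite hansen_vertices; apply: sub_convex_hull.
  by exists (s, I); rewrite //= inE.
have full x (U : {vspace E}) : hansen R e `<=` affine_subspace x U -> U = fullv.
  move=> PU.
  have IU I : stable e I -> (1, \sum_(i in I) unit_vector R i) \in U.
    move=> sI; have [u uU xu] := PU _ (Pvertex false I sI).
    have [v vU xv] := PU _ (Pvertex true I sI).
    have : u - v \in U by rewrite memvB.
    have -> : u - v = 2 *: (1 : R^o, \sum_(i in I) unit_vector R i).
      have -> : u - v = (x + u) - (x + v) by rewrite opprD addrACA subrr add0r.
      rewrite xu xv /vertex /= expr0 expr1 scale1r scaleN1r opprK.
      by rewrite scaler_nat mulr2n.
    by move=> /(memvZ 2^-1); rewrite scalerA mulVf ?pnatr_eq0 // scale1r.
  have U0 : (1 : R^o, 0 : {ffun V -> R^o}) \in U.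
    have := IU finset.set0; rewrite big_set0; apply.
    by apply/forallP => y; rewrite inE.
  have Ui i : (0 : R^o, unit_vector R i) \in U.
    have si : stable e (finset.set1 i).
      apply/forallP => y; apply/implyP; rewrite inE => /eqP ->.
      by apply/forallP => z; apply/implyP; rewrite inE => /eqP ->; rewrite e_irr.
    have := memvB (IU _ si) U0; rewrite big_set1.
    by have -> : (1 : R^o, unit_vector R i) - (1, 0) = (0, unit_vector R i) :> E
      by congr (_, _) => /=; rewrite ?subrr ?subr0.
  apply/vspaceP => -[x0 y]; rewrite memvf.
  have -> : (x0, y) = x0 *: (1 : R^o, 0 : {ffun V -> R^o}) +
      \sum_i (y i : R) *: (0 : R^o, unit_vector R i).
    have -> : \sum_i (y i : R) *: (0 : R^o, unit_vector R i) = (0, y) :> E.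
      rewrite [LHS]surjective_pairing; congr (_, _).
        by rewrite (raddf_sum fst) big1 // => i _ /=; exact: scaler0.
      rewrite (raddf_sum snd) /=; apply/ffunP => j.
      rewrite sum_ffunE (bigD1 j) //= big1.
        by rewrite !ffunE eqxx /= addr0 /GRing.scale /= mulr1.
      by move=> i ij; rewrite !ffunE eq_sym (negbTE ij) /GRing.scale /= mulr0.
    congr (_, _) => /=; first by rewrite addr0 /GRing.scale /= mulr1.
    by rewrite scaler0 add0r.
  by rewrite memvD ?memvZ // memv_suml // => i _; rewrite memvZ.
have hullT : affine_hull (hansen R e) = affine_subspace 0 fullv.
  apply/seteqP; split.
    apply: smallest_sub; first by exists 0, fullv.
    by move=> x _; exists x; rewrite ?add0r //= memvf.
  move=> x _ A [[y [U ->]] /full ->]; exists (x - y); first exact: memvf.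
  by rewrite addrC subrK.
rewrite /dimension; case: xgetP => [U _ [x hU]|/(_ fullv) []]; last by exists 0.
suff -> : U = fullv.
  by rewrite dimvf -[LHS]/(1 + #|V| * 1)%N muln1.
by apply: (full x); rewrite -hU; exact: sub_gen_smallest.
Qed.

Definition linear_form (c0 : R) (a : V -> R) (x : E) : R :=
  c0 * x.1 + \sum_i a i * x.2 i.

Fact linear_form_linear c0 a : linear_for *%R (linear_form c0 a).
Proof.
move=> k x y; rewrite /linear_form /= mulrDr mulrCA mulrDr mulr_sumr addrACA.
congr (_ + _); rewrite -big_split /=; apply: eq_bigr => i _.
by rewrite !ffunE mulrDr mulrCA.
Qed.
HB.instance Definition _ c0 a :=
  GRing.isLinear.Build R E R *%R (linear_form c0 a) (linear_form_linear c0 a).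

Definition vertex_value (c0 : R) (a : V -> R) (t : bool * {set V}) : R :=
  (-1) ^+ t.1 * (c0 + \sum_(i in t.2) a i).

Lemma linear_form_vertex c0 a t :
  linear_form c0 a (vertex t) = vertex_value c0 a t.
Proof.
rewrite /vertex linearZ /= /vertex_value; congr (_ * _).
rewrite /linear_form /= mulr1; congr (_ + _).
rewrite [RHS]big_mkcond; apply: eq_bigr => i _ /=; rewrite sum_ffunE.
case: ifP => it.
  rewrite (bigD1 i) //= big1 ?ffunE ?eqxx ?addr0 ?mulr1 // => j /andP[_ ji].
  by rewrite ffunE eq_sym (negbTE ji).
rewrite big1 ?mulr0 // => j jt; rewrite ffunE; case: eqP jt it => // <-.
by move=> ->.
Qed.

Lemma scalar_vertex (c : {scalar E}) t :
  c (vertex t) = vertex_value (c (1, 0)) (fun i => c (0, unit_vector R i)) t.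
Proof.
rewrite /vertex linearZ /= /vertex_value; congr (_ * _).
rewrite -linear_sum -linearD /=; congr (c _).
rewrite [RHS]surjective_pairing; congr (_, _) => /=.
  by rewrite (raddf_sum fst) big1 ?addr0.
by rewrite (raddf_sum snd) add0r.
Qed.

Lemma supporting_vertexP X :
  supporting vertex signed_stable_sets X <->
  exists c0 a b,
    (forall t, stable e t.2 -> vertex_value c0 a t <= b) /\
    (forall t, (t \in X) = stable e t.2 && (vertex_value c0 a t == b)).
Proof.
split=> [[c [b [cb cX]]]|[c0 [a [b [cb cX]]]]].
  exists (c (1, 0)), (fun i => c (0, unit_vector R i)), b.
  split=> t; rewrite -scalar_vertex; last by rewrite cX inE.
  by move=> st; apply: cb; rewrite inE.
exists (linear_form c0 a), b.
by split=> t; rewrite ?cX inE /= linear_form_vertex //; exact: cb.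
Qed.
End Hansen.

(** * Stable sets of a split graph and codes of faces *)

Section Codes.
Variables (V : finType) (e : rel V) (C : {set V}).
Hypotheses (e_sym : symmetric e) (e_irr : irreflexive e).
Hypotheses (clC : clique e C) (stS : stable e (~: C)).

(** The branch of a stable set: its only element in the clique, if it has one. *)
Definition clique_part (I : {set V}) : option V := [pick c in C :&: I].

Definition admissible (o : option V) : bool :=
  if o is Some c then c \in C else true.

(** The elements outside the clique that a stable set of the branch [o] can
contain; they can be chosen independently. *)
Definition available (o : option V) (i : V) : bool :=
  (i \notin C) && (if o is Some c then ~~ e c i else true).

Lemma clique_part_ok I : admissible (clique_part I).
Proof. by rewrite /clique_part; case: pickP => //= c; rewrite inE => /andP[]. Qed.

Lemma stable_edge I x y : stable e I -> x \in I -> y \in I -> ~~ e x y.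
Proof. by move=> /forall_inP sI xI yI; move: (sI x xI) => /forall_inP; apply. Qed.

Lemma stable_split I i : stable e I -> i \in I ->
  (Some i == clique_part I) || available (clique_part I) i.
Proof.
move=> sI iI; rewrite /clique_part /available.
case: pickP => [c|noC] /=.
  rewrite inE => /andP[cC cI]; rewrite (stable_edge sI cI iI) andbT.
  case: (boolP (i \in C)) => iC; rewrite ?orbT // orbF; apply/eqP; congr Some.
  apply: contraTeq (stable_edge sI iI cI) => ic; rewrite negbK.
  by move/forall_inP: clC => /(_ i iC) /forall_inP /(_ c cC) /implyP; apply.
by move: (noC i); rewrite inE iI andbT => ->.
Qed.

Lemma clique_part_mem I c : clique_part I = Some c -> c \in I.
Proof.
by rewrite /clique_part; case: pickP => //= x; rewrite inE => /andP[_ xI] [<-].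
Qed.

Definition assemble (o : option V) (T : pred V) : {set V} :=
  [set i | (Some i == o) || (available o i && T i)].

Lemma assemble_stable o T : stable e (assemble o T).
Proof.
apply/forall_inP => x; rewrite inE => hx; apply/forall_inP => y; rewrite inE => hy.
move: hx hy; rewrite /available; case: o => [c|] /=; last first.
  move=> /andP[/andP[xS _] _] /andP[/andP[yS _] _].
  by apply: (stable_edge stS); rewrite inE.
case/orP=> [/eqP[->]|/andP[/andP[xS cx] _]];
  case/orP=> [/eqP[->]|/andP[/andP[yS cy] _]] //.
- by rewrite e_irr.
- by rewrite e_sym.
- by apply: (stable_edge stS); rewrite inE.
Qed.

Lemma clique_part_assemble o T : admissible o -> clique_part (assemble o T) = o.
Proof.
move=> ok; rewrite /clique_part; case: pickP => [c|noC].
  by rewrite !inE /available => /andP[cC]; rewrite cC /= orbF => /eqP.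
by case: o ok noC => //= c cC /(_ c); rewrite !inE cC eqxx.
Qed.

Lemma assemble_available o T i :
  admissible o -> available o i -> (i \in assemble o T) = T i.
Proof.
move=> ok oi; rewrite inE oi /=; case: eqP => //= io; move: oi ok.
by rewrite /available -io /= => /andP[/negbTE ->].
Qed.

(** The bits tell whether the branch [None] is maximal with the sign [+] and with
the sign [-]. In the sign vector [None] is the sign [0], and [Some s] is the sign
[(-1)^s]. *)
Definition code : Type := (bool * bool * {ffun V -> option bool})%type.
Implicit Types (k : code) (r : {ffun V -> option bool}).

Definition touched r c : bool := [exists i in ~: C, e c i && (r i != None)].

(** Properties (A) and (B) for the signed elements of the clique and of the stable
set. *)
Definition clique_has_neighbors r : bool :=
  [forall c in C, (r c != None) ==> touched r c].

Definition stable_has_nonneighbors r : bool :=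
  [forall i in ~: C, (r i != None) ==>
     [exists c in C, (r c != None) && ~~ e i c]].

Definition clique_signed r : bool := [exists c in C, r c != None].

(** The codes that functionals have. If both bits are set, the branch of a
signed [c] is maximal with one sign only, so its mass is less than that of [None],
which means that [c] has a signed neighbor. If no bit is set, some branch of a clique element
has to be maximal, and only the signs visible from such branches are recorded. *)
Definition valid_code k : bool :=
  let: (b0, b1, r) := k in
  if b0 && b1 then clique_has_neighbors r
  else [|| b0, b1 | stable_has_nonneighbors r && clique_signed r].

(** The branches that are maximal with the sign [s]. When both bits are set, the
branch of an unsigned [c] is maximal with neither sign or with both, and having a
signed neighbor distinguishes the two cases. *)
Definition active_branch k (s : bool) (o : option V) : bool :=
  let: (b0, b1, r) := k in
  if o is Some c then (r c == Some s) || [&& b0, b1 & ~~ touched r c]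
  else if s then b1 else b0.

(** A maximizer takes the available elements whose sign is its own, leaves those
of the opposite sign and is free on the unsigned ones. *)
Definition code_face k : {set bool * {set V}} :=
  [set t : bool * {set V} |
    [&& stable e t.2, active_branch k t.1 (clique_part t.2)
      & [forall i, available (clique_part t.2) i ==>
           ((k.2 i == Some t.1) ==> (i \in t.2)) &&
           ((k.2 i == Some (~~ t.1)) ==> (i \notin t.2))]]].

Lemma assemble_code_face k s o T : admissible o -> active_branch k s o ->
  (forall i, (k.2 i == Some s) ==> T i) ->
  (forall i, (k.2 i == Some (~~ s)) ==> ~~ T i) ->
  (s, assemble o T) \in code_face k.
Proof.
move=> ok act Tp Tm; rewrite inE /= assemble_stable clique_part_assemble // act /=.
by apply/forallP => i; apply/implyP => oi; rewrite !assemble_available // Tp Tm.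
Qed.

Lemma code_face_neq0 k : valid_code k -> code_face k != finset.set0.
Proof.
move=> vk.
suff [s [o [ok act]]] : exists s o, admissible o /\ active_branch k s o.
  apply/set0Pn; exists (s, assemble o (fun i => k.2 i == Some s)).
  apply: assemble_code_face => // i; first exact/implyP.
  by case: (k.2 i) => [[]|]; case: (s).
case: k vk => [[[] []] r] /=;
  [by exists true, None|by exists false, None|by exists true, None|].
move=> /andP[_ /existsP[c /andP[cC]]].
case E : (r c) => [s|]; rewrite ?eqxx // => _.
by exists s, (Some c); rewrite /= E eqxx.
Qed.

Lemma active_sub k k' s o : admissible o -> code_face k = code_face k' ->
  active_branch k s o -> active_branch k' s o.
Proof.
move=> ok kk' act.
have : (s, assemble o (fun i => k.2 i == Some s)) \in code_face k'.
  rewrite -kk'; apply: assemble_code_face => // i; first exact/implyP.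
  by case: (k.2 i) => [[]|]; case: (s).
by rewrite inE /= clique_part_assemble // => /and3P[].
Qed.

(** On a maximal branch, the members of the face that take as few and as many
available elements as possible agree exactly on the signed elements, so the face
shows the signs of all elements available on that branch. *)
Lemma sign_sub k k' s u o i : admissible o -> code_face k = code_face k' ->
  active_branch k s o -> available o i -> k'.2 i = Some u -> k.2 i = Some u.
Proof.
move=> ok kk' act oi.
have mem T : (forall i, (k.2 i == Some s) ==> T i) ->
    (forall i, (k.2 i == Some (~~ s)) ==> ~~ T i) ->
    ((k'.2 i == Some s) ==> T i) && ((k'.2 i == Some (~~ s)) ==> ~~ T i).
  move=> Tp Tm; have := assemble_code_face ok act Tp Tm.
  rewrite kk' inE /= clique_part_assemble // => /and3P[_ _ /forallP /(_ i)].
  by rewrite oi !assemble_available.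
have dist j : (k.2 j == Some s) ==> (k.2 j != Some (~~ s)).
  by case: (k.2 j) => [[]|]; case: (s).
have dist' j : (k.2 j == Some (~~ s)) ==> (k.2 j != Some s).
  by case: (k.2 j) => [[]|]; case: (s).
have /andP[/implyP p _] := mem _ (fun j => implybb (k.2 j == Some s)) dist'.
have /andP[_ /implyP m] : ((k'.2 i == Some s) ==> (k.2 i != Some (~~ s))) &&
    ((k'.2 i == Some (~~ s)) ==> ~~ (k.2 i != Some (~~ s))).
  apply: (mem (fun j => k.2 j != Some (~~ s))) => // j.
  by rewrite negbK implybb.
move=> ku; have [us|us] := eqVneq u s.
  by move: ku p; rewrite us => -> /(_ (eqxx _)) /eqP.
have {us}us : u = ~~ s by case: (u) (s) us => [] [].
by move: ku m; rewrite us => -> /(_ (eqxx _)); rewrite negbK => /eqP.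
Qed.

(** The sign of [c] can be read off the maximal branches: property (A) excludes
that [c] is signed while its branch is maximal with both signs. *)
Lemma valid_clique b0 b1 r s c : valid_code (b0, b1, r) -> c \in C ->
  (r c == Some s) =
  active_branch (b0, b1, r) s (Some c) &&
  ~~ active_branch (b0, b1, r) (~~ s) (Some c).
Proof.
rewrite /active_branch => vk cC; case: (boolP [&& _, _ & _]); last first.
  by rewrite !orbF; case: (r c) => [[]|]; case: (s).
move=> /and3P[b0T b1T ntc]; move: vk.
rewrite /= b0T b1T /= => /forall_inP /(_ c cC).
by rewrite (negbTE ntc) implybF negbK !orbT => /eqP ->.
Qed.

(** A sign outside the clique is visible on some maximal branch. If no bit is
set, property (B) provides such a branch. *)
Lemma valid_stable b0 b1 r i :
  valid_code (b0, b1, r) -> i \notin C -> r i != None ->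
  exists s o, [/\ admissible o, active_branch (b0, b1, r) s o & available o i].
Proof.
move=> vk iC ri; move: vk; rewrite /valid_code.
case: ifP => [/andP[-> ->] _|_].
  by exists true, None; rewrite /available /= iC.
case/or3P => [->|->|/andP[/forall_inP /(_ i)]].
- by exists false, None; rewrite /available /= iC.
- by exists true, None; rewrite /available /= iC.
rewrite inE ri iC => /(_ isT) /= /existsP[c /and3P[cC rc ic]] _.
case E: (r c) rc => [s|] // _.
by exists s, (Some c); rewrite /available /= E eqxx cC iC e_sym ic.
Qed.

Lemma code_face_inj : {in [pred k | valid_code k] &, injective code_face}.
Proof.
move=> [[b0 b1] r] [[b0' b1'] r']; rewrite !inE => vk vk' kk'.
set k := (b0, b1, r) in vk kk' *; set k' := (b0', b1', r') in vk' kk' *.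
have act s o : admissible o -> active_branch k s o = active_branch k' s o.
  by move=> ok; apply/idP/idP; apply: active_sub.
have b0E : b0 = b0' by exact: (act false None isT).
have b1E : b1 = b1' by exact: (act true None isT).
suff rE : r = r' by rewrite /k /k' b0E b1E rE.
have opt (x y : option bool) :
    (forall s, (x == Some s) = (y == Some s)) -> x = y.
  move=> xy; case: x xy => [s|] xy.
    by have /esym/eqP := xy s; rewrite eqxx.
  by case: y xy => // s /(_ s); rewrite eqxx.
apply/ffunP => i; case: (boolP (i \in C)) => iC.
  by apply: opt => s; rewrite (valid_clique s vk iC) (valid_clique s vk' iC) !act.
have [/andP[/eqP -> /eqP ->] //|] := boolP ((r i == None) && (r' i == None)).
rewrite negb_and => nN.
have [s [o [ok ao oi]]] : exists s o,
    [/\ admissible o, active_branch k s o & available o i].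
  case/orP: nN => ri; first exact: (valid_stable vk iC ri).
  by have [s [o [ok ao oi]]] := valid_stable vk' iC ri; exists s, o; rewrite act.
have ao' : active_branch k' s o by rewrite -act.
apply: opt => u; apply/idP/idP => /eqP ru; apply/eqP.
  exact: (sign_sub ok (esym kk') ao' oi ru).
exact: (sign_sub ok kk' ao oi ru).
Qed.
End Codes.

(** * Every functional has a code and every code a functional *)

Section Functionals.
Local Open Scope ring_scope.
Variables (R : realType) (V : finType) (e : rel V) (C : {set V}).
Hypotheses (e_sym : symmetric e) (e_irr : irreflexive e).
Hypotheses (clC : clique e C) (stS : stable e (~: C)).
Implicit Types (h b : R) (a : V -> R) (s : bool) (o : option V).

(** The maximum over the stable sets of the branch [o] with the sign [s]. *)
Definition branch_max h a s o : R :=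
  (-1) ^+ s * (h + oapp a 0 o) +
  \sum_(i | available e C o i) Num.max 0 ((-1) ^+ s * a i).

Definition mass a o : R := \sum_(i | available e C o i) `|a i|.

Lemma sum_stable a I : stable e I ->
  \sum_(i in I) a i = oapp a 0 (clique_part C I) +
    \sum_(i | available e C (clique_part C I) i) (if i \in I then a i else 0).
Proof.
move=> sI; rewrite -big_mkcondr /=; case E : (clique_part C I) => [c|] /=.
  have cI := clique_part_mem E; rewrite (bigD1 c) //=; congr (_ + _).
  apply: eq_bigl => i; case: (boolP (i \in I)) => iI; rewrite ?andbF ?andbT //=.
  have := stable_split clC sI iI; rewrite E.
  have cC : c \in C by have := clique_part_ok C I; rewrite E.
  case: eqVneq => [[->]|ic]; first by rewrite /available cC eqxx.
  by rewrite orFb => ->; apply: contra_neq ic => ->.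
rewrite add0r; apply: eq_bigl => i.
case: (boolP (i \in I)) => iI; rewrite ?andbF ?andbT //=.
by have := stable_split clC sI iI; rewrite E orFb => ->.
Qed.

Lemma max0_leif (x : R) (m : bool) :
  (if m then x else 0) <= Num.max 0 x ?= iff
    ((0 < x) ==> m) && ((x < 0) ==> ~~ m).
Proof.
apply/leifP; case: (ltrgt0P x) => [x0|x0|->]; case: m => /=;
  rewrite /Order.max ?ltxx ?eqxx ?x0 ?(lt_gtF x0) ?eqxx //.
Qed.

Lemma vertex_value_leif h a s I : stable e I ->
  vertex_value h a (s, I) <= branch_max h a s (clique_part C I) ?= iff
    [forall (i | available e C (clique_part C I) i),
       ((0 < (-1) ^+ s * a i) ==> (i \in I)) &&
       (((-1) ^+ s * a i < 0) ==> (i \notin I))].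
Proof.
move=> sI; rewrite /vertex_value /= (sum_stable a sI) addrA mulrDr mulr_sumr.
rewrite -[X in _ <= _ ?= iff X]andTb; apply: leifD; first exact/leif_refl.
apply: leif_sum => i _.
have -> : (-1) ^+ s * (if i \in I then a i else 0) =
    if i \in I then (-1) ^+ s * a i else 0 by case: ifP; rewrite ?mulr0.
exact: max0_leif.
Qed.

(** The two signs give opposite values to [h] and to the clique element, and
[max 0 x + max 0 (- x) = `|x|] at each available element. *)
Lemma branch_max_sum h a o :
  branch_max h a false o + branch_max h a true o = mass a o.
Proof.
rewrite /branch_max expr0 expr1 addrACA -big_split mul1r mulN1r subrr add0r /=.
apply: eq_bigr => i _; rewrite mul1r mulN1r.
by case: (ger0P (a i)) => ai; rewrite /Order.max; case: ltP; case: ltP; lra.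
Qed.

Lemma mass_leif a o :
  mass a o <= mass a None ?= iff
    [forall (i | i \notin C), available e C o i || (a i == 0)].
Proof.
rewrite /mass.
have -> : \sum_(i | available e C o i) `|a i| =
    \sum_(i | i \notin C) (if available e C o i then `|a i| else 0).
  rewrite -big_mkcondr; apply: eq_bigl => i; rewrite /available.
  by case: (i \in C).
rewrite [X in _ <= X ?= iff _](eq_bigl (fun i => i \notin C)) /=; last first.
  by move=> i; rewrite /available andbT.
apply: leif_sum => i _; case: (available e C o i) => /=; first exact/leif_refl.
by apply/leifP; case: eqP => [->|/eqP ai]; rewrite ?normr0 ?normr_gt0.
Qed.

Definition sign (x : R) : option bool :=
  if 0 < x then Some false else if x < 0 then Some true else None.

Lemma sign_eq s (x : R) : (sign x == Some s) = (0 < (-1) ^+ s * x).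
Proof.
by rewrite /sign; case: s; rewrite ?expr0 ?expr1 ?mul1r ?mulN1r ?oppr_gt0;
  case: (ltrgt0P x).
Qed.

Lemma sign_eqN s (x : R) : (sign x == Some (~~ s)) = ((-1) ^+ s * x < 0).
Proof.
rewrite sign_eq; case: s; rewrite expr0 expr1 mul1r mulN1r.
  by rewrite oppr_lt0.
by rewrite oppr_gt0.
Qed.

Lemma sign_eq0 (x : R) : (sign x == None) = (x == 0).
Proof. by rewrite /sign; case: (ltrgt0P x). Qed.

(** The code describes the maximizers of [(h, a)], whose maximum is [b]: it names
the maximal branches and the signs of the coefficients that they can see. *)
Definition encodes h a b (k : code V) : Prop :=
  (forall s o, admissible C o ->
     branch_max h a s o <= b ?= iff active_branch e C k s o) /\
  (forall s o i, admissible C o -> active_branch e C k s o ->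
     available e C o i -> k.2 i = sign (a i)).

Lemma encodes_code_face h a b k : encodes h a b k ->
  forall t, stable e t.2 ->
    vertex_value h a t <= b ?= iff (t \in code_face e C k).
Proof.
move=> [ktop ksign] [s I] /= sI; have ok := clique_part_ok C I.
have := leif_trans (vertex_value_leif h a s sI) (ktop s _ ok).
rewrite inE /= sI /= andbC; case: (boolP (active_branch _ _ _ _ _)) => //= act.
congr (_ <= _ ?= iff _); apply: eq_forallb => i.
case: (boolP (available _ _ _ _)) => //= oi.
by rewrite (ksign _ _ _ ok act oi) sign_eq sign_eqN.
Qed.

(** The coefficients outside the clique are the signs of the code. Then the maxima
[w o] of the branches with the sign [+] can be prescribed by the choice of [h] and
of the coefficients on the clique, and those with the sign [-] are
[mass a' o - w o]. It remains to choose a maximum [b] with [mass a' o <= 2 b], with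
equality exactly on the branches that are to be maximal with both signs. *)
Lemma code_functional k : exists h a b, encodes h a b k.
Proof.
case: k => [[b0 b1] r].
pose a' i : R := if r i is Some s then (-1) ^+ s else 0.
have a'0 i : (a' i == 0) = (r i == None).
  by rewrite /a'; case: (r i) => [s|]; rewrite ?signr_eq0 ?eqxx.
pose n := mass a' None.
(* If no branch is to be maximal with both signs, any [b > n / 2] will do. *)
pose b := if b0 && b1 then n / 2 else n + 1.
pose k : code V := (b0, b1, r).
have n0 : 0 <= n by apply: sumr_ge0.
have nb o : admissible C o -> mass a' o <= 2 * b ?= iff
    active_branch e C k false o && active_branch e C k true o.
  move=> ok; have := mass_leif a' o; rewrite -/n /b; case: ifP => b01; last first.
    move=> [mo _]; apply/leifP; case: ifP => [|_]; last by lra.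
    case: o ok mo => /= [c _ _|_ _]; last by rewrite b01.
    have -> : [&& b0, b1 & ~~ touched e C r c] = false by rewrite andbA b01.
    by rewrite !orbF; case: (r c) => [[]|].
  have -> : 2 * (n / 2) = n by lra.
  congr (_ <= _ ?= iff _); case: o ok => [c|_] /=; last first.
    by rewrite b01; apply/forall_inP => i iC; rewrite /available iC.
  move: b01 => /andP[-> ->] cC /=.
  have -> : [forall (i | i \notin C), available e C (Some c) i || (a' i == 0)] =
      ~~ touched e C r c.
    rewrite /touched negb_exists; apply: eq_forallb => i.
    rewrite inE /available a'0 /=; case: (i \in C) => //=.
    by rewrite negb_and negbK.
  by case: (touched _ _ _ _); case: (r c) => [[]|].
pose up o := \sum_(i | available e C o i) Num.max 0 (a' i).
(* A branch that is not to be maximal shares its mass equally between the signs,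
   which keeps both maxima below [b]. *)
pose w o := if active_branch e C k false o then b
            else if active_branch e C k true o then mass a' o - b
            else mass a' o / 2.
pose h := w None - up None.
pose a i := if i \in C then w (Some i) - up (Some i) - h else a' i.
have aa' o i : available e C o i -> a i = a' i.
  by rewrite /available /a => /andP[/negbTE ->].
have topF o : admissible C o -> branch_max h a false o = w o.
  move=> ok; rewrite /branch_max expr0 mul1r.
  have -> : \sum_(i | available e C o i) Num.max 0 (1 * a i) = up o.
    by apply: eq_bigr => i oi; rewrite mul1r (aa' o).
  by case: o ok => [c|] /= cC; rewrite /a ?cC /h; lra.
have topT o : admissible C o -> branch_max h a true o = mass a' o - w o.
  move=> ok; have : mass a o = mass a' o.
    by apply: eq_bigr => i oi; rewrite (aa' o).
  by rewrite -(branch_max_sum h) topF // => <-; lra.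
exists h, a, b; split=> [s o ok|s o i ok act oi]; last first.
  rewrite (aa' _ _ oi) /a' /=; case: (r i) => [[]|];
    by rewrite /sign ?expr0 ?expr1 ?ltr01 ?ltrN10 ?ltr0N1 ?ltxx.
have /leifP := nb o ok; rewrite -/k => nb_o; apply/leifP; move: nb_o.
by case: s; rewrite ?topT ?topF // /w -/k;
  case: (active_branch e C k false o);
  case: (active_branch e C k true o) => /=; lra.
Qed.

Lemma branch_max_attained h a s o : admissible C o ->
  exists2 I, stable e I & vertex_value h a (s, I) = branch_max h a s o.
Proof.
move=> ok; pose T i := 0 < (-1) ^+ s * a i.
have sI : stable e (assemble e C o T) by exact: assemble_stable.
exists (assemble e C o T) => //.
have := vertex_value_leif h a s sI; rewrite clique_part_assemble // => -[_ E].
apply/eqP; rewrite E; apply/forall_inP => i oi.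
rewrite assemble_available // /T implybb.
by apply/implyP => ai; rewrite -leNgt ltW.
Qed.

(** The maximal branches and the visible signs define the code. That
[active_branch] recovers the maximal branches and that the code is valid
follows from a comparison of masses ([actC]): [Some c] is maximal with both
signs if and only if its mass is [2 b], hence if and only if [None] is maximal
with both signs and has the same mass, that is, [c] has no neighbor with a
nonzero coefficient. *)
Lemma functional_code h a b :
  (forall t, stable e t.2 -> vertex_value h a t <= b) ->
  (exists2 t, stable e t.2 & vertex_value h a t = b) ->
  exists2 k, valid_code e C k & encodes h a b k.
Proof.
move=> vb [[s0 I0] /= sI0 vI0].
have topb s o : admissible C o -> branch_max h a s o <= b.
  by move=> ok; have [I sI <-] := branch_max_attained h a s ok; exact: vb.
pose act s o := branch_max h a s o == b.
have act0 : exists s o, admissible C o && act s o.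
  exists s0, (clique_part C I0); rewrite clique_part_ok /=.
  have := (vertex_value_leif h a s0 sI0).1; rewrite vI0 => ge.
  by rewrite /act eq_le ge topb ?clique_part_ok.
have actC c : c \in C -> act false (Some c) && act true (Some c) =
    [&& act false None, act true None
      & [forall (i | i \notin C), available e C (Some c) i || (a i == 0)]].
  move=> cC; have := mass_leif a (Some c); rewrite -!(branch_max_sum h) => /leifP.
  have := topb false None isT; have := topb true None isT.
  have := topb false (Some c) cC; have := topb true (Some c) cC.
  rewrite /act; case: ifP => _ t1 t2 t3 t4 m; rewrite ?andbT ?andbF.
    by apply/andP/andP => -[/eqP p /eqP q]; split; apply/eqP; lra.
  by apply/negP => /andP[/eqP p /eqP q]; lra.
pose r := [ffun i => if i \in C then
    if act false (Some i) && ~~ act true (Some i) then Some false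
    else if act true (Some i) && ~~ act false (Some i) then Some true else None
  else if [exists s, exists o, [&& admissible C o, act s o & available e C o i]]
    then sign (a i) else None].
pose k : code V := (act false None, act true None, r).
have rS s o i :
    admissible C o -> act s o -> available e C o i -> r i = sign (a i).
  move=> ok ao oi; rewrite ffunE; have /andP[/negbTE -> _] := oi.
  case: ifP => // /existsP[]; exists s; apply/existsP; exists o.
  by rewrite ok ao oi.
have untouched c : act false None -> act true None ->
    ~~ touched e C r c =
    [forall (i | i \notin C), available e C (Some c) i || (a i == 0)].
  move=> a0 a1; rewrite negb_exists; apply: eq_forallb => i.
  rewrite inE; case: (boolP (i \in C)) => //= iC; rewrite /available iC /=.
  by rewrite (rS false None) // ?/available ?iC // sign_eq0 negb_and negbK.
have activeE s o : admissible C o -> active_branch e C k s o = act s o.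
  case: o => [c|_]; last by case: s.
  move=> /= cC; have := actC c cC; rewrite ffunE cC.
  have -> : [&& act false None, act true None & ~~ touched e C r c] =
    [&& act false None, act true None
      & [forall (i | i \notin C), available e C (Some c) i || (a i == 0)]].
    case: (boolP (act false None)) => //= a0.
    case: (boolP (act true None)) => //= a1.
    exact: untouched.
  move=> <-; case: s; case: (act false (Some c)); by case: (act true (Some c)).
exists k; last first.
  split=> [s o ok|s o i ok]; last by rewrite activeE //; exact: rS.
  by rewrite activeE //; split; first exact: topb.
rewrite /valid_code /k; case: ifP => [/andP[a0 a1]|].
  apply/forall_inP => c cC; apply/implyP; apply: contraR.
  rewrite untouched // => uc.
  have /andP[ac0 ac1] : act false (Some c) && act true (Some c).
    by rewrite actC // a0 a1.
  by rewrite ffunE cC ac0 ac1.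
case: (boolP (act false None)) => //= a0.
case: (boolP (act true None)) => //= a1 _.
have rC s c : c \in C -> act s (Some c) -> r c != None.
  move=> cC; have := actC c cC; rewrite (negbTE a0) andFb ffunE cC.
  by case: s; case: (act false (Some c)); case: (act true (Some c)).
apply/andP; split.
  apply/forall_inP => i; rewrite inE => iC; apply/implyP.
  rewrite ffunE (negbTE iC).
  case: ifP => // /existsP[s /existsP[[c|] /and3P[cC ac ci]]] _; last first.
    by case: s ac => ac; [case/negP: a1|case/negP: a0].
  have {}cC : c \in C := cC.
  apply/existsP; exists c; rewrite cC (rC s) //=.
  by move: ci; rewrite /available e_sym => /andP[].
have [s [[c|] /andP[cC ac]]] := act0; last first.
  by case: s ac => ac; [case/negP: a1|case/negP: a0].
have {}cC : c \in C := cC.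
by apply/existsP; exists c; rewrite cC (rC s).
Qed.

Lemma supporting_code_face :
  finset (fun X : {set bool * {set V}} =>
    (X != finset.set0) &&
    `[< supporting (@vertex R V) (signed_stable_sets e) X >]) =
  imset (code_face e C) (mem [pred k | valid_code e C k]).
Proof.
apply/setP => X; rewrite inE; apply/idP/imsetP.
  move=> /andP[/set0Pn[t tX] /asboolP /supporting_vertexP [h [a [b [vb Xb]]]]].
  have [|k vk enc] := functional_code vb.
    by exists t; move: tX; rewrite Xb => /andP[st /eqP].
  exists k => //; apply/setP => u; rewrite Xb.
  case: (boolP (stable e u.2)) => su /=; last by rewrite inE (negbTE su).
  by rewrite (encodes_code_face enc su).
move=> [k vk ->]; rewrite (code_face_neq0 e_sym e_irr stS) //=.
apply/asboolP/supporting_vertexP; have [h [a [b enc]]] := code_functional k.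
exists h, a, b; split=> t.
  by move=> st; exact: (encodes_code_face enc st).1.
case: (boolP (stable e t.2)) => st /=; last by rewrite inE (negbTE st).
by rewrite (encodes_code_face enc st).
Qed.

Theorem face_count_hansen :
  face_count (hansen R e) = #|[pred k | valid_code e C k]|.
Proof.
rewrite hansen_vertices face_count_convex_hull supporting_code_face.
rewrite card_in_imset //.
exact: code_face_inj.
Qed.
End Functionals.

(** * The number of codes *)

Section Counting.
Variables (V : finType) (e : rel V) (C : {set V}).
Hypothesis e_sym : symmetric e.
Implicit Types (r : {ffun V -> option bool}).

Lemma disjoint_union3P (A X Y Z : {set V}) :
  reflect (forall i, [&& (i \in A) == [|| i \in X, i \in Y | i \in Z],
             ~~ ((i \in X) && (i \in Y)), ~~ ((i \in X) && (i \in Z))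
           & ~~ ((i \in Y) && (i \in Z))])
    (disjoint_union3 A X Y Z).
Proof.
rewrite /disjoint_union3 -!setI_eq0.
apply: (iffP and4P) => [[/eqP -> /eqP/setP XY /eqP/setP XZ /eqP/setP YZ] i|H].
  by move: (XY i) (XZ i) (YZ i); rewrite !inE -orbA eqxx => -> -> ->.
split; apply/eqP/setP => i;
  move/and4P: (H i) => [/eqP a /negbTE xy /negbTE xz /negbTE yz];
  by rewrite !inE ?a ?orbA.
Qed.

Definition sign_parts r :
    {set V} * {set V} * {set V} * {set V} * {set V} * {set V} :=
  ([set i in C | r i == Some false], [set i in C | r i == Some true],
   [set i in C | r i == None], [set i in ~: C | r i == Some false],
   [set i in ~: C | r i == Some true], [set i in ~: C | r i == None]).

Lemma sign_parts_inj : injective sign_parts.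
Proof.
move=> r r' [/setP h1 /setP h2 _ /setP h3 /setP h4 _]; apply/ffunP => i.
move: (h1 i) (h2 i) (h3 i) (h4 i); rewrite !inE; case: (i \in C) => /=;
  by case: (r i) => [[]|]; case: (r' i) => [[]|].
Qed.

(** Given (B), a sign vector that vanishes on the clique vanishes everywhere, so
being nonzero is the same as being nonzero on the clique. *)
Lemma p_count_codes :
  p_count e C (~: C) =
  #|[pred r | clique_has_neighbors e C r &&
       (stable_has_nonneighbors e C r && clique_signed C r)]|.
Proof.
rewrite -(card_imset _ sign_parts_inj); apply: eq_card => t; rewrite inE.
pose sup r (A : {set V}) :=
  [set i in A | r i == Some false] :|: [set i in A | r i == Some true].
have supp r (A : {set V}) i : (i \in sup r A) = (i \in A) && (r i != None).
  by rewrite !inE; case: (i \in A) => //=; case: (r i) => [[]|].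
have union3 r (A : {set V}) : disjoint_union3 A [set j in A | r j == Some false]
    [set j in A | r j == Some true] [set j in A | r j == None].
  apply/disjoint_union3P => i; rewrite !inE.
  by case: (i \in A) => //=; case: (r i) => [[]|].
have mem r : (let: (Cp, Cm, C0, Sp, Sm, S0) := sign_parts r in
      [&& disjoint_union3 C Cp Cm C0, disjoint_union3 (~: C) Sp Sm S0,
          (Cp :|: Cm != finset.set0) || (Sp :|: Sm != finset.set0),
          [forall x in Cp :|: Cm, exists y in Sp :|: Sm, e x y]
        & [forall y in Sp :|: Sm, exists x in Cp :|: Cm, ~~ e y x]]) =
    clique_has_neighbors e C r &&
    (stable_has_nonneighbors e C r && clique_signed C r).
  rewrite /sign_parts !union3 /= -/(sup r C) -/(sup r (~: C)).
  have -> : [forall x in sup r C, exists y in sup r (~: C), e x y] =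
      clique_has_neighbors e C r.
    apply: eq_forallb => x; rewrite supp; case: (x \in _) => //=; congr (_ ==> _).
    by apply: eq_existsb => y; rewrite supp -andbA; congr (_ && _); rewrite andbC.
  have -> : [forall x in sup r (~: C), exists y in sup r C, ~~ e x y] =
      stable_has_nonneighbors e C r.
    apply: eq_forallb => x; rewrite supp; case: (x \in _) => //=; congr (_ ==> _).
    by apply: eq_existsb => y; rewrite supp -andbA.
  rewrite andbC -andbA; congr (_ && _).
  case: (boolP (stable_has_nonneighbors e C r)) => //= cB.
  have -> : clique_signed C r = (sup r C != finset.set0).
    by apply/existsP/set0Pn => -[i Hi]; exists i; move: Hi; rewrite supp.
  case: eqP => //= C0; apply/negbTE; rewrite negbK; apply/eqP/setP => i.
  rewrite supp finset.in_set0; apply/negP => /andP[iS ri].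
  move/forall_inP: cB => /(_ i iS); rewrite ri => /existsP[c /and3P[cC rc _]].
  by have := supp r C c; rewrite C0 finset.in_set0 cC rc.
apply/idP/imsetP => [|[r /= Hr ->]]; last by rewrite mem.
move: t => [[[[[Cp Cm] C0] Sp] Sm] S0] Ht.
pose r := [ffun i => if (i \in Cp) || (i \in Sp) then Some false
                     else if (i \in Cm) || (i \in Sm) then Some true else None].
have tr : (Cp, Cm, C0, Sp, Sm, S0) = sign_parts r.
  case/and3P: Ht => /disjoint_union3P HC /disjoint_union3P HS _.
  rewrite /sign_parts; congr (_, _, _, _, _, _); apply/setP => i;
  move: (HC i) (HS i);
  rewrite !inE ffunE; case: (i \in C); case: (i \in Cp); case: (i \in Cm);
  case: (i \in C0); case: (i \in Sp); case: (i \in Sm); by case: (i \in S0).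
by exists r; rewrite // inE -mem -tr.
Qed.

(** If (A) fails then some signed [c] has no signed neighbor, so it is a
nonneighbor of every signed element outside the clique. *)
Lemma neighbors_or_nonneighbors r :
  clique_has_neighbors e C r ||
  (stable_has_nonneighbors e C r && clique_signed C r).
Proof.
rewrite -implyNb; apply/implyP => /forall_inPn[c cC].
rewrite negb_imply => /andP[rc ntc].
apply/andP; split; last by apply/existsP; exists c; rewrite cC.
apply/forall_inP => i iS; apply/implyP => ri; apply/existsP; exists c.
rewrite cC rc /=; apply: contra ntc => ic; apply/existsP; exists i.
by rewrite iS ri e_sym ic.
Qed.

(** The codes with one bit contribute [2 * 3 ^ #|V|]. The codes with two bits and
those with none are counted together by inclusion and exclusion: the union of
their sets of sign vectors is everything, and the intersection is counted by
[p_count]. *)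
Lemma card_valid_code :
  #|[pred k | valid_code e C k]| = (3 ^ #|V|.+1 + p_count e C (~: C))%N.
Proof.
pose A := [pred r | clique_has_neighbors e C r].
pose B := [pred r | stable_has_nonneighbors e C r && clique_signed C r].
have T : #|{: {ffun V -> option bool}}| = (3 ^ #|V|)%N.
  by rewrite card_ffun card_option card_bool.
have AB : (#|A| + #|B| = 3 ^ #|V| + p_count e C (~: C))%N.
  rewrite p_count_codes -cardUI -T; congr (_ + _)%N; apply: eq_card => r.
  by rewrite !inE; exact: neighbors_or_nonneighbors.
rewrite expnS !mulSn mul0n addn0 -addnA -addnA -AB -T.
pose v b0 b1 r : bool := valid_code e C (b0, b1, r).
have -> : #|[pred k | valid_code e C k]| = (\sum_b0 \sum_b1 \sum_r v b0 b1 r)%N.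
  rewrite pair_bigA pair_bigA -sum1_card big_mkcond /=.
  apply: eq_bigr => -[[b0 b1] r] _.
  transitivity (nat_of_bool (v b0 b1 r)); last by [].
  by rewrite inE -/(v b0 b1 r); case: (v b0 b1 r).
have S (P : pred {ffun V -> option bool}) : (\sum_r P r = #|[pred r | P r]|)%N.
  rewrite -sum1_card [RHS]big_mkcond; apply: eq_bigr => r _.
  by rewrite inE; case: (P r).
rewrite !big_bool /= !S !sum1_card.
rewrite -[X in (X + _ + _)%N]/#|A| -[X in (_ + (_ + X))%N]/#|B|.
by rewrite [(#|A| + _)%N]addnC -addnA [(#|A| + _)%N]addnCA.
Qed.
End Counting.

Theorem theorem4p6 (R : realType) (V : finType) (e : rel V) (C S : {set V})
    (d : nat) (He : simple_graph e) (HCS : split_partition e C S)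
    (Hd : #|V| = (d - 1)%N) (Hd0 : (0 < d)%N) :
  face_count (hansen R e) = (3 ^ d + p_count e C S)%N /\
  [/\ centrally_symmetric (hansen R e),
      dimension (hansen R e) = d
    & (3 ^ d <= face_count (hansen R e))%N].
Proof.
case: He HCS => e_sym e_irr [CS dCS clC stS].
have dE : d = #|V|.+1 by rewrite Hd subn1 prednK.
have SE : S = ~: C.
  apply/setP => i; move/setP/(_ i): CS; rewrite !inE.
  case: (boolP (i \in C)) => [iC _|_ /= -> //].
  by rewrite (disjointFr dCS iC).
subst S d.
have faces := face_count_hansen R e_sym e_irr clC stS.
rewrite (card_valid_code _ e_sym) in faces.
split=> //; split; [exact: hansen_centrally_symmetric|exact: dimension_hansen|].
by rewrite faces leq_addr.
Qed.
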